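(* Let $R$ be a commutative Noetherian ring with unity, with total ring of fractions $Q(R)$, and let $M$ be a finitely generated $R$-module. Let $\Omega_R M$ be the first syzygy in some projective resolution of $M$. If $M$ is an $R$-submodule of $Q(R)$ and $M$ contains a non-zero-divisor of $R$, then $$\operatorname{tr}_R(M)=\mathbb T_0(M,\operatorname{Mod} R)=\operatorname{ann}_R \operatorname{Tor}^R_1(M,\operatorname{Tr} M)=\mathbb E^0(M,\operatorname{Mod} R)=\operatorname{ann}_R\operatorname{Ext}^1_R(M,\Omega_R M).$$
   Context: $\operatorname{Mod} R$ denotes the category of all $R$-modules. $Q(R)$ is the localization of $R$ at the set of all its non-zero-divisors, and $R$ is regarded as a subring of $Q(R)$; ''$M$ contains a non-zero-divisor of $R$'' means that some element of $M\cap R$ is a non-zero-divisor of $R$. For an $R$-module $X$, $\operatorname{ann}_R X=\{r\in R: rX=0\}$. The trace ideal of an $R$-module $M$ is $\operatorname{tr}_R(M)=\sum_{f\in \operatorname{Hom}_R(M,R)}\operatorname{Im}(f)$, an ideal of $R$. The following ideals are defined: $\mathbb T_0(M,\operatorname{Mod} R)=\bigcap_{i>0}\bigcap_{N\in\operatorname{Mod} R}\operatorname{ann}_R\operatorname{Tor}^R_i(M,N)$ and $\mathbb E^0(M,\operatorname{Mod} R)=\bigcap_{i>0}\bigcap_{N\in\operatorname{Mod} R}\operatorname{ann}_R\operatorname{Ext}_R^i(M,N)$. The first syzygy $\Omega_R M$ in a projective resolution of $M$ is the kernel of the augmentation: there is an exact sequence $0\to\Omega_R M\to P\to M\to 0$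 with $P$ projective. $\operatorname{Tr} M$ denotes the Auslander transpose of the finitely generated module $M$: take a presentation $P_1\xrightarrow{f}P_0\to M\to 0$ with $P_0,P_1$ finitely generated projective, and let $\operatorname{Tr} M$ be the cokernel of $f^\ast:P_0^\ast\to P_1^\ast$, where $(-)^\ast=\operatorname{Hom}_R(-,R)$; it is uniquely determined up to projective summands. *)

(* Defs.v *)
From HB Require Import structures.
From mathcomp Require Import all_boot all_order all_algebra.
From mathcomp Require Import boolp classical_sets.
From mathcomp Require Import generic_quotient.

Set Implicit Arguments.
Unset Strict Implicit.
Unset Printing Implicit Defensive.

Import GRing.Theory.
Local Open Scope ring_scope.
Local Open Scope classical_set_scope.
Local Open Scope quotient_scope.

(* A submodule of [V] is a [submodClosed V]; predicates that are not decidable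
   are made boolean by [asbool], which assumes classical logic. *)

Section Submodule.
Variables (R : pzRingType) (V : lmodType R) (W : submodClosed V).

Record submod := Submod { submod_val : V; submod_valP : submod_val \in W }.

HB.instance Definition _ := [isSub for submod_val].
HB.instance Definition _ := [Choice of submod by <:].
HB.instance Definition _ := [SubChoice_isSubLmodule of submod by <:].

End Submodule.

Section QuotientModule.
Variables (R : pzRingType) (V : lmodType R) (W : submodClosed V).

Definition quotmod_rel (x y : V) : bool := (x - y) \in W.

Fact submodClosedN (x : V) : x \in W -> - x \in W.
Proof. by move=> xW; rewrite -scaleN1r rpredZ. Qed.

Fact quotmod_rel_equiv : equiv_class_of quotmod_rel.
Proof.
split=> [x|x y|y x z]; rewrite /quotmod_rel ?subrr ?rpred0 //.
  by apply/idP/idP => /submodClosedN; rewrite opprB.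
by move=> xy yz; rewrite -[x](subrK y) -addrA rpredD.
Qed.

Canonical quotmod_equiv := EquivRelPack quotmod_rel_equiv.

Definition quotmod : Type := {eq_quot quotmod_rel}.
HB.instance Definition _ : EqQuotient V quotmod_rel quotmod :=
  EqQuotient.on quotmod.
HB.instance Definition _ := Choice.on quotmod.

Definition quotmod_proj (x : V) : quotmod := \pi_quotmod x.
Local Notation proj := quotmod_proj.

Lemma quotmod_projP (x y : V) : proj x = proj y <-> (x - y) \in W.
Proof. by split=> [/eqmodP|h]; last apply/eqmodP. Qed.

Lemma quotmod_reprP (u : quotmod) : exists x, u = proj x.
Proof. by exists (repr u); rewrite /proj reprK. Qed.

Definition quotmod_zero : quotmod := proj 0.
Definition quotmod_opp (u : quotmod) : quotmod := proj (- repr u).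
Definition quotmod_add (u v : quotmod) : quotmod := proj (repr u + repr v).
Definition quotmod_scale (a : R) (u : quotmod) : quotmod := proj (a *: repr u).

Let projK x : repr (proj x) - x \in W.
Proof. by apply/quotmod_projP; rewrite /proj reprK. Qed.

Let oppE x : quotmod_opp (proj x) = proj (- x).
Proof. by apply/quotmod_projP; rewrite -opprD submodClosedN. Qed.

Let addE x y : quotmod_add (proj x) (proj y) = proj (x + y).
Proof. by apply/quotmod_projP; rewrite opprD addrACA rpredD. Qed.

Let scaleE a x : quotmod_scale a (proj x) = proj (a *: x).
Proof. by apply/quotmod_projP; rewrite -scalerBr rpredZ. Qed.

Fact quotmod_addA : associative quotmod_add.
Proof.
move=> u v w; have [x ->] := quotmod_reprP u; have [y ->] := quotmod_reprP v.
by have [z ->] := quotmod_reprP w; rewrite !addE addrA.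
Qed.

Fact quotmod_addC : commutative quotmod_add.
Proof. by move=> u v; rewrite /quotmod_add addrC. Qed.

Fact quotmod_add0 : left_id quotmod_zero quotmod_add.
Proof. by move=> u; have [x ->] := quotmod_reprP u; rewrite addE add0r. Qed.

Fact quotmod_addN : left_inverse quotmod_zero quotmod_opp quotmod_add.
Proof.
by move=> u; have [x ->] := quotmod_reprP u; rewrite oppE addE addNr.
Qed.

HB.instance Definition _ := GRing.isZmodule.Build quotmod
  quotmod_addA quotmod_addC quotmod_add0 quotmod_addN.

Let addrE x y : proj x + proj y = proj (x + y). Proof. exact: addE. Qed.

Fact quotmod_scaleA a b u :
  quotmod_scale a (quotmod_scale b u) = quotmod_scale (a * b) u.
Proof. by have [x ->] := quotmod_reprP u; rewrite !scaleE scalerA. Qed.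

Fact quotmod_scale1 : left_id 1 quotmod_scale.
Proof. by move=> u; have [x ->] := quotmod_reprP u; rewrite scaleE scale1r. Qed.

Fact quotmod_scaleDr : right_distributive quotmod_scale +%R.
Proof.
move=> a u v; have [x ->] := quotmod_reprP u; have [y ->] := quotmod_reprP v.
by rewrite addrE !scaleE addrE scalerDr.
Qed.

Fact quotmod_scaleDl u : {morph quotmod_scale^~ u : a b / a + b}.
Proof.
move=> a b; have [x ->] := quotmod_reprP u.
by rewrite !scaleE addrE scalerDl.
Qed.

HB.instance Definition _ := GRing.Zmodule_isLmodule.Build R quotmod
  quotmod_scaleA quotmod_scale1 quotmod_scaleDr quotmod_scaleDl.

Fact quotmod_proj_linear : linear quotmod_proj.
Proof.
by move=> a x y; rewrite -addrE; congr (_ + _); rewrite -scaleE.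
Qed.

HB.instance Definition _ :=
  GRing.isLinear.Build R V quotmod *:%R quotmod_proj quotmod_proj_linear.

End QuotientModule.

Section KernelImage.
Variables (R : pzRingType) (U V : lmodType R) (f : {linear U -> V}).

Definition kermod : {pred U} := [pred x | f x == 0].

Fact kermod_closed : submod_closed kermod.
Proof.
split; rewrite ?inE ?linear0 // => a x y; rewrite !inE => /eqP fx /eqP fy.
by rewrite linearP fx fy scaler0 addr0.
Qed.

HB.instance Definition _ := GRing.isSubmodClosed.Build R U kermod kermod_closed.

Definition immod : {pred V} := [pred y | `[< exists x, f x = y >]].

Fact immod_closed : submod_closed immod.
Proof.
split; first by apply/asboolP; exists 0; exact: linear0.
move=> a _ _ /asboolP[x <-] /asboolP[y <-].
by apply/asboolP; exists (a *: x + y); rewrite linearP.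
Qed.

HB.instance Definition _ := GRing.isSubmodClosed.Build R V immod immod_closed.

Definition ker : lmodType R := submod kermod.
Definition coker : lmodType R := quotmod immod.

Definition ker_incl (z : ker) : U := submod_val (z : submod kermod).

Fact ker_incl_linear : linear ker_incl.
Proof.
exact: (linearP (val : {linear submod (kermod : submodClosed U) -> U})).
Qed.

HB.instance Definition _ :=
  GRing.isLinear.Build R ker U *:%R ker_incl ker_incl_linear.

End KernelImage.

Section Homology.
Variables (R : pzRingType) (A B C : lmodType R).
Variables (f : {linear A -> B}) (g : {linear B -> C}).

Definition boundaries : {pred ker g} := [pred z | ker_incl z \in immod f].

Fact boundaries_closed : submod_closed boundaries.
Proof.
split; first by rewrite unfold_in raddf0; exact: (rpred0 (immod f)).
move=> a x y hx hy; rewrite unfold_in linearP.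
exact: (rpredD (rpredZ a hx) hy).
Qed.

HB.instance Definition _ :=
  GRing.isSubmodClosed.Build R (ker g) boundaries boundaries_closed.

(* homology at [B] of [A --f--> B --g--> C] *)
Definition homology : lmodType R := quotmod boundaries.

End Homology.

Section HomModule.
Variables (R : comPzRingType) (U V : lmodType R).

(* A separate name for [{linear U -> V}], to carry the module structure. *)
Definition hom : Type := {linear U -> V}.
HB.instance Definition _ := gen_eqMixin hom.
HB.instance Definition _ := gen_choiceMixin hom.

Lemma homP (f g : hom) : (f : {linear U -> V}) =1 (g : {linear U -> V}) -> f = g.
Proof.
case: f => f [[fa] [fs]]; case: g => g [[ga] [gs]] /= /funext fg.
move: fg fa fs ga gs => -> fa fs ga gs.
by rewrite (Prop_irrelevance fa ga) (Prop_irrelevance fs gs).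
Qed.

Definition hom_zero : hom := \0 : {linear U -> V}.
Definition hom_opp (f : hom) : hom := (\- (f : {linear U -> V})) : {linear U -> V}.
Definition hom_add (f g : hom) : hom :=
  ((f : {linear U -> V}) \+ (g : {linear U -> V})) : {linear U -> V}.
Definition hom_scale (a : R) (f : hom) : hom :=
  (a \*: (f : {linear U -> V})) : {linear U -> V}.

Fact hom_addA : associative hom_add.
Proof. by move=> f g h; apply: homP => x; apply: addrA. Qed.

Fact hom_addC : commutative hom_add.
Proof. by move=> f g; apply: homP => x; apply: addrC. Qed.

Fact hom_add0 : left_id hom_zero hom_add.
Proof. by move=> f; apply: homP => x; apply: add0r. Qed.

Fact hom_addN : left_inverse hom_zero hom_opp hom_add.
Proof. by move=> f; apply: homP => x; apply: addNr. Qed.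

Fact hom_scaleA a b f : hom_scale a (hom_scale b f) = hom_scale (a * b) f.
Proof. by apply: homP => x; apply: scalerA. Qed.

Fact hom_scale1 : left_id 1 hom_scale.
Proof. by move=> f; apply: homP => x; apply: scale1r. Qed.

Fact hom_scaleDr : right_distributive hom_scale hom_add.
Proof. by move=> a f g; apply: homP => x; apply: scalerDr. Qed.

Fact hom_scaleDl f a b : hom_scale (a + b) f = hom_add (hom_scale a f) (hom_scale b f).
Proof. by apply: homP => x; apply: scalerDl. Qed.

HB.instance Definition _ := GRing.isZmodule.Build hom
  hom_addA hom_addC hom_add0 hom_addN.

HB.instance Definition _ := GRing.Zmodule_isLmodule.Build R hom
  hom_scaleA hom_scale1 hom_scaleDr hom_scaleDl.

End HomModule.


Section HomMap.
Variables (R : comPzRingType) (A B N : lmodType R) (f : {linear A -> B}).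

Definition hom_precomp (g : hom B N) : hom A N :=
  (g : {linear B -> N}) \o f : {linear A -> N}.

Fact hom_precomp_linear : linear hom_precomp.
Proof. by move=> a g h; apply: homP. Qed.

HB.instance Definition _ := GRing.isLinear.Build R (hom B N) (hom A N) *:%R
  hom_precomp hom_precomp_linear.

End HomMap.

Arguments hom_precomp {R A B} N f.

(* The tensor product: finite formal sums of pairs, modulo the smallest
   congruence for concatenation making the class of [:: (x, y)] bilinear. *)
Section Tensor.
Variables (R : comPzRingType) (M N : lmodType R).

Inductive tensor_eq : seq (M * N) -> seq (M * N) -> Prop :=
| TensorRefl s : tensor_eq s s
| TensorSym s t : tensor_eq s t -> tensor_eq t s
| TensorTrans s t u : tensor_eq s t -> tensor_eq t u -> tensor_eq s u
| TensorCat s s' t t' :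
    tensor_eq s s' -> tensor_eq t t' -> tensor_eq (s ++ t) (s' ++ t')
| TensorCatC s t : tensor_eq (s ++ t) (t ++ s)
| TensorZero y : tensor_eq [:: (0, y)] [::]
| TensorAddl x x' y : tensor_eq [:: (x + x', y)] [:: (x, y); (x', y)]
| TensorAddr x y y' : tensor_eq [:: (x, y + y')] [:: (x, y); (x, y')]
| TensorScale a x y : tensor_eq [:: (a *: x, y)] [:: (x, a *: y)].

Definition tensor_rel (s t : seq (M * N)) : bool := `[< tensor_eq s t >].

Fact tensor_rel_equiv : equiv_class_of tensor_rel.
Proof.
split=> [s|s t|t s u]; first exact/asboolP/TensorRefl.
  by apply/asboolP/asboolP => /TensorSym.
by move=> /asboolP st /asboolP tu; apply/asboolP/(TensorTrans st tu).
Qed.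

Canonical tensor_equiv := EquivRelPack tensor_rel_equiv.

Definition tensor : Type := {eq_quot tensor_rel}.
HB.instance Definition _ : EqQuotient (seq (M * N)) tensor_rel tensor :=
  EqQuotient.on tensor.
HB.instance Definition _ := Choice.on tensor.

Definition tensor_class (s : seq (M * N)) : tensor := \pi_tensor s.
Local Notation cl := tensor_class.

Lemma tensor_classP s t : cl s = cl t <-> tensor_eq s t.
Proof. by split=> [/eqmodP/asboolP|h]; last apply/eqmodP/asboolP. Qed.

Lemma tensor_reprP (u : tensor) : exists s, u = cl s.
Proof. by exists (repr u); rewrite /cl reprK. Qed.

Definition tensor_zero : tensor := cl [::].
Definition tensor_add (u v : tensor) : tensor := cl (repr u ++ repr v).
Definition tensor_scale (a : R) (u : tensor) : tensor :=
  cl [seq (a *: p.1, p.2) | p <- repr u].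
Definition tensor_opp (u : tensor) : tensor := tensor_scale (-1) u.

Let reprE s : tensor_eq (repr (cl s)) s.
Proof. by apply/tensor_classP; rewrite /cl reprK. Qed.

Let addE s t : tensor_add (cl s) (cl t) = cl (s ++ t).
Proof. exact/tensor_classP/TensorCat. Qed.

Let scale_eq a s t : tensor_eq s t ->
  tensor_eq [seq (a *: p.1, p.2) | p <- s] [seq (a *: p.1, p.2) | p <- t].
Proof.
elim=> {s t} [s|s t _|s t u _ st _|s s' t t' _ ss _ tt|s t|y|x x' y|x y y'|b x y].
- exact: TensorRefl.
- exact: TensorSym.
- exact: TensorTrans.
- by rewrite !map_cat; apply: TensorCat.
- by rewrite !map_cat; apply: TensorCatC.
- by rewrite /= scaler0; apply: TensorZero.
- by rewrite /= scalerDr; apply: TensorAddl.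
- exact: TensorAddr.
by rewrite /= scalerA mulrC -scalerA; apply: TensorScale.
Qed.

Let scaleE a s : tensor_scale a (cl s) = cl [seq (a *: p.1, p.2) | p <- s].
Proof. exact/tensor_classP/scale_eq. Qed.

Fact tensor_addA : associative tensor_add.
Proof.
move=> u v w; have [s ->] := tensor_reprP u; have [t ->] := tensor_reprP v.
by have [r ->] := tensor_reprP w; rewrite !addE catA.
Qed.

Fact tensor_addC : commutative tensor_add.
Proof.
move=> u v; have [s ->] := tensor_reprP u; have [t ->] := tensor_reprP v.
by rewrite !addE; apply/tensor_classP/TensorCatC.
Qed.

Fact tensor_add0 : left_id tensor_zero tensor_add.
Proof. by move=> u; have [s ->] := tensor_reprP u; rewrite addE. Qed.

Fact tensor_scaleDl u :
  {morph tensor_scale^~ u : a b / a + b >-> tensor_add a b}.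
Proof.
move=> a b; have [s ->] := tensor_reprP u; rewrite !scaleE addE.
apply/tensor_classP; elim: s => [|[x y] s IHs] /=; first exact: TensorRefl.
rewrite scalerDl -cat1s.
apply: TensorTrans (TensorCat (TensorAddl _ _ _) IHs) _.
rewrite -cat1s /= -[_ :: _ :: _]/([:: (a *: x, y)] ++ _) -[X in tensor_eq _ X]cat1s.
apply: TensorCat; first exact: TensorRefl.
rewrite -cat1s -[X in tensor_eq _ (_ ++ X)]cat1s !catA.
by apply: TensorCat; [apply: TensorCatC|apply: TensorRefl].
Qed.

Let scale0 u : tensor_scale 0 u = tensor_zero.
Proof.
have [s ->] := tensor_reprP u; rewrite scaleE; apply/tensor_classP.
elim: s => [|[x y] s IHs] /=; first exact: TensorRefl.
rewrite scale0r -cat1s -[[::]]cats0.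
exact: (TensorCat (TensorZero y)).
Qed.

Fact tensor_scale1 : left_id 1 tensor_scale.
Proof.
move=> u; have [s ->] := tensor_reprP u; rewrite scaleE.
by congr cl; elim: s => //= -[x y] s ->; rewrite scale1r.
Qed.

Fact tensor_addN : left_inverse tensor_zero tensor_opp tensor_add.
Proof.
by move=> u; rewrite -{2}[u]tensor_scale1 -tensor_scaleDl addNr scale0.
Qed.

HB.instance Definition _ := GRing.isZmodule.Build tensor
  tensor_addA tensor_addC tensor_add0 tensor_addN.

Fact tensor_scaleA a b u :
  tensor_scale a (tensor_scale b u) = tensor_scale (a * b) u.
Proof.
have [s ->] := tensor_reprP u; rewrite !scaleE -map_comp.
by congr cl; apply: eq_map => -[x y] /=; rewrite scalerA.
Qed.

Fact tensor_scaleDr : right_distributive tensor_scale +%R.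
Proof.
move=> a u v; have [s ->] := tensor_reprP u; have [t ->] := tensor_reprP v.
rewrite [cl s + _]addE !scaleE map_cat; exact/esym/addE.
Qed.

HB.instance Definition _ := GRing.Zmodule_isLmodule.Build R tensor
  tensor_scaleA tensor_scale1 tensor_scaleDr tensor_scaleDl.

Definition tmul (x : M) (y : N) : tensor := cl [:: (x, y)].

Lemma tensor_class_nil : cl [::] = 0. Proof. by []. Qed.

Lemma tensor_class_cons p s : cl (p :: s) = tmul p.1 p.2 + cl s.
Proof. by case: p => x y; rewrite -cat1s; apply/esym/addE. Qed.

Lemma tensor_class_scale a s :
  a *: cl s = cl [seq (a *: p.1, p.2) | p <- s].
Proof. exact: scaleE. Qed.

Lemma tensor_class_cat s t : cl (s ++ t) = cl s + cl t.
Proof. exact/esym/addE. Qed.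

Lemma tmul_linearl y : linear (tmul^~ y).
Proof.
move=> a x x'; rewrite tensor_class_scale -tensor_class_cat.
exact/tensor_classP/TensorAddl.
Qed.

Lemma tmul_linearr x : linear (tmul x).
Proof.
move=> a y y'; rewrite tensor_class_scale -tensor_class_cat.
apply/tensor_classP/(TensorTrans (TensorAddr _ _ _)).
apply: (TensorCat (s := [:: _]) (s' := [:: _])); last exact: TensorRefl.
exact/TensorSym/TensorScale.
Qed.

Section Lift.
Variables (L : lmodType R) (b : M -> N -> L).
Hypotheses (bl : forall y, linear (b^~ y)) (br : forall x, linear (b x)).

Definition tensor_lift (u : tensor) : L := \sum_(p <- repr u) b p.1 p.2.

Let bD x x' y : b (x + x') y = b x y + b x' y.
Proof. by have := bl y 1 x x'; rewrite !scale1r. Qed.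

Let b0 y : b 0 y = 0.
Proof. by apply: (addIr (b 0 y)); rewrite -bD !add0r. Qed.

Let bDr x y y' : b x (y + y') = b x y + b x y'.
Proof. by have := br x 1 y y'; rewrite !scale1r. Qed.

Let b0r x : b x 0 = 0.
Proof. by apply: (addIr (b x 0)); rewrite -bDr !add0r. Qed.

Let bZ a x y : b (a *: x) y = a *: b x y.
Proof. by have := bl y a x 0; rewrite !addr0 b0 addr0. Qed.

Let bZr a x y : b x (a *: y) = a *: b x y.
Proof. by have := br x a y 0; rewrite !addr0 b0r addr0. Qed.

Lemma tensor_lift_class s : tensor_lift (cl s) = \sum_(p <- s) b p.1 p.2.
Proof.
rewrite /tensor_lift; move: (reprE s); move: (repr _) => t.
elim=> {s t} //.
- by move=> s t u _ -> _ ->.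
- by move=> s s' t t' _ es _ et; rewrite !big_cat /= es et.
- by move=> s t; rewrite !big_cat [LHS]addrC.
- by move=> y; rewrite big_seq1 big_nil b0.
- by move=> x x' y; rewrite !big_cons big_nil /= bD !addr0.
- by move=> x y y'; rewrite !big_cons big_nil /= bDr !addr0.
by move=> a x y; rewrite !big_seq1 /= bZ bZr.
Qed.

Lemma tensor_liftE x y : tensor_lift (tmul x y) = b x y.
Proof. by rewrite tensor_lift_class big_seq1. Qed.

Lemma tensor_lift_linear : linear tensor_lift.
Proof.
move=> a u v; have [s ->] := tensor_reprP u; have [t ->] := tensor_reprP v.
rewrite tensor_class_scale -tensor_class_cat !tensor_lift_class big_cat big_map.
by rewrite scaler_sumr /=; congr (_ + _); apply: eq_bigr => p _; rewrite bZ.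
Qed.

End Lift.

Lemma tensor_ext (L : lmodType R) (f g : {linear tensor -> L}) :
  (forall x y, f (tmul x y) = g (tmul x y)) -> f =1 g.
Proof.
move=> fg u; have [s ->] := tensor_reprP u.
elim: s => [|p s IHs]; first by rewrite !linear0.
by rewrite tensor_class_cons !linearD fg IHs.
Qed.

End Tensor.

Section TensorMap.
Variables (R : comPzRingType) (A B N : lmodType R) (f : {linear A -> B}).

(* f (x) id_N *)
Definition tensor_map : tensor A N -> tensor B N :=
  tensor_lift (fun x y => tmul (f x) y).

Fact tensor_map_linear : linear tensor_map.
Proof.
apply: tensor_lift_linear => [y a x x'|x]; last exact: tmul_linearr.
by rewrite linearP tmul_linearl.
Qed.

HB.instance Definition _ := GRing.isLinear.Build R (tensor A N) (tensor B N)
  *:%R tensor_map tensor_map_linear.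

Lemma tensor_mapE x y : tensor_map (tmul x y) = tmul (f x) y.
Proof.
apply: tensor_liftE => [z a u u'|u]; last exact: tmul_linearr.
by rewrite linearP tmul_linearl.
Qed.

End TensorMap.

Arguments tensor_map {R A B} N f.

Section Notions.
Variable R : comPzRingType.

Definition nonzerodivisor (s : R) : Prop := GRing.lreg s.

Definition fin_gen (M : lmodType R) : Prop :=
  exists n (g : 'I_n -> M), forall x, exists c : 'I_n -> R,
    x = \sum_i c i *: g i.

Definition noetherian : Prop :=
  forall I : submodClosed R^o, fin_gen (submod I).

Definition projective (P : lmodType R) : Prop :=
  forall (A B : lmodType R) (p : {linear A -> B}) (f : {linear P -> B}),
    (forall b, exists a, p a = b) ->
    exists h : {linear P -> A}, forall x, p (h x) = f x.

Definition ann (X : lmodType R) : set R := [set r | forall x : X, r *: x = 0].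

Definition trace_ideal (M : lmodType R) : set R :=
  [set r | exists n (f : 'I_n -> {linear M -> R^o}) (m : 'I_n -> M),
     r = \sum_i f i (m i)].

(* ... -> res_term 1 -> res_term 0 -> M -> 0, exact, with projective terms *)
Record proj_resolution (M : lmodType R) := ProjResolution {
  res_term :> nat -> lmodType R;
  res_diff : forall n, {linear res_term n.+1 -> res_term n};
  res_aug : {linear res_term 0%N -> M};
  res_proj : forall n, projective (res_term n);
  res_aug_surj : forall x, exists y, res_aug y = x;
  res_exact0 : forall x, res_aug x = 0 <-> exists y, res_diff 0 y = x;
  res_exactS : forall n x,
    res_diff n x = 0 <-> exists y, res_diff n.+1 y = x
}.

Definition syzygy (M : lmodType R) (P : proj_resolution M) : lmodType R :=
  ker (res_aug P).

(* Tor and Ext are computed from a given projective resolution of [M], hence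
   depend on it up to isomorphism; the statement quantifies over the resolution. *)
Definition Tor (M : lmodType R) (P : proj_resolution M) (i : nat)
    (N : lmodType R) : lmodType R :=
  let d n := tensor_map N (res_diff P n) in
  if i is k.+1 then homology (d k.+1) (d k) else coker (d 0%N).

Definition Ext (M : lmodType R) (P : proj_resolution M) (i : nat)
    (N : lmodType R) : lmodType R :=
  let d n := hom_precomp N (res_diff P n) in
  if i is k.+1 then homology (d k) (d k.+1) else ker (d 0%N).

Definition T0 (M : lmodType R) (P : proj_resolution M) : set R :=
  [set r | forall i, (0 < i)%N -> forall N : lmodType R, ann (Tor P i N) r].

Definition E0 (M : lmodType R) (P : proj_resolution M) : set R :=
  [set r | forall i, (0 < i)%N -> forall N : lmodType R, ann (Ext P i N) r].

Record fp_presentation (M : lmodType R) := FpPresentation {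
  pres_P1 : lmodType R;
  pres_P0 : lmodType R;
  pres_map : {linear pres_P1 -> pres_P0};
  pres_aug : {linear pres_P0 -> M};
  pres_fin_gen1 : fin_gen pres_P1;
  pres_fin_gen0 : fin_gen pres_P0;
  pres_proj1 : projective pres_P1;
  pres_proj0 : projective pres_P0;
  pres_aug_surj : forall x, exists y, pres_aug y = x;
  pres_exact : forall x, pres_aug x = 0 <-> exists y, pres_map y = x
}.

Definition transpose (M : lmodType R) (p : fp_presentation M) : lmodType R :=
  coker (hom_precomp R^o (pres_map p)).

(* [iota] exhibits [Q] as the localization of [R] at its non-zero-divisors;
   this determines [Q] up to a unique isomorphism under [R], and [iota] is then
   injective. *)
Record is_total_fractions (Q : comPzRingType) (iota : {rmorphism R -> Q}) :
    Prop := IsTotalFractions {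
  tf_unit : forall s, nonzerodivisor s -> exists q, iota s * q = 1;
  tf_frac : forall q, exists a s, nonzerodivisor s /\ q * iota s = iota a;
  tf_eq : forall a b, iota a = iota b ->
    exists2 s, nonzerodivisor s & s * a = s * b
}.

End Notions.

(* Main.v *)
Require Import Defs.
From HB Require Import structures.
From mathcomp Require Import all_boot all_order all_algebra.
From mathcomp Require Import boolp classical_sets.

(** All five ideals are the set of those [r] in [R] for which multiplication by
    [r] on [M] factors through a projective module; [scalar_lifts e r] says so
    for one chosen surjection [e] onto [M].

    The link with the trace ideal comes from [M] lying in [Q].  A linear form
    [f] on [M] is multiplication by some fraction, so [f m *: x = f x *: m] for
    all [m] and [x] ([tf_hom_exchange]).  Hence multiplication by [f m] is the
    composite of [f : M -> R] with [1 |-> m], and every element of the trace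
    ideal lifts ([trace_scalar_lifts]).  Conversely, a lift of [r] through a
    projective module gives, in terms of generators [b i] of [M], an expansion
    [r *: x = \sum_i f i x *: b i = (\sum_i f i (b i)) *: x]; for [x] a
    non-zero-divisor of [R] lying in [M] one can cancel [x]
    ([scalar_lifts_trace]).

    If [r] lifts through the augmentation of a projective resolution, then
    multiplication by [r] on the resolution is null-homotopic in positive
    degrees, so [r] kills every higher Tor and Ext ([scalar_lifts_T0],
    [scalar_lifts_E0]).

    Finally, one Ext group and one Tor group suffice to recover the lift,
    because each contains a class that represents the identity of [M].  In
    Ext^1 (M, Omega M) it is the class of the syzygy extension
    ([Ext_scalar_lifts]).  In Tor_1 (M, Tr M) it comes from the isomorphism of
    this module with the endomorphisms of [M] modulo those that factor through
    a projective module; only the class of the identity is needed, and it is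
    written down explicitly ([Tor_scalar_lifts]). *)

Set Implicit Arguments.
Unset Strict Implicit.
Unset Printing Implicit Defensive.

Import GRing.Theory.
Local Open Scope ring_scope.

(** * Linear maps, projective modules and lifts of scalars *)

Section LinearMaps.
Variable R : comPzRingType.
Implicit Types A B F M N U V X : lmodType R.

Lemma linear_bundle {U V} (f : U -> V) :
  linear f -> exists g : {linear U -> V}, g =1 f.
Proof.
move=> lf; pose L := GRing.isLinear.Build R U V *:%R f lf.
by exists (HB.pack f L : {linear U -> V}).
Qed.

Lemma corestrict {A B} (W : submodClosed B) (f : {linear A -> B}) :
    (forall x, f x \in W) ->
  exists f' : {linear A -> submod W}, forall x, val (f' x) = f x.
Proof.
move=> Wf.
have [|f' f'E] := @linear_bundle A (submod W) (fun x => Submod (Wf x)).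
  by move=> a x y; apply: val_inj; rewrite [RHS]linearP; exact: linearP.
by exists f' => x; rewrite f'E.
Qed.

(** Projectivity in the form used along exact sequences: [d] is made surjective
    by replacing its codomain with its image. *)
Lemma projective_lift {F A B} (d : {linear A -> B}) (f : {linear F -> B}) :
    projective F -> (forall z, exists x, d x = f z) ->
  exists h : {linear F -> A}, forall z, d (h z) = f z.
Proof.
move=> projF fd; set W : submodClosed B := immod d.
have [|d' d'E] := @corestrict A B W d; first by move=> x; apply/asboolP; exists x.
have [|f' f'E] := @corestrict F B W f; first by move=> z; apply/asboolP.
have [|h hE] := projF _ _ d' f'.
  move=> y; have /asboolP[x dx] := submod_valP y.
  by exists x; apply: val_inj; rewrite d'E.
by exists h => z; rewrite -d'E hE f'E.
Qed.

Lemma linear_factor {F M X} (e : {linear F -> M}) (k : {linear F -> X}) :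
    (forall x, exists y, e y = x) -> (forall y, e y = 0 -> k y = 0) ->
  exists g : {linear M -> X}, forall y, g (e y) = k y.
Proof.
move=> /choice[s es] k0.
have kE y y' : e y = e y' -> k y = k y'.
  move=> ee; apply/eqP; rewrite -subr_eq0 -linearB; apply/eqP/k0.
  by rewrite linearB ee subrr.
have [|g gE] := @linear_bundle M X (fun x => k (s x)).
  by move=> a x y; rewrite -linearP; apply: kE; rewrite linearP !es.
by exists g => y; rewrite gE; apply: kE; rewrite es.
Qed.

(** The map [e] lifts to the free module on the indices of the generators
    [g i], and [phi i] is the [i]-th coordinate of the lift.  The source [F]
    may be infinitely generated; when [e] is the identity, this is a finite
    dual basis of [F]. *)
Lemma projective_coord {F M} (e : {linear F -> M}) n (g : 'I_n -> M) :
    projective F -> (forall x, exists c : 'I_n -> R, x = \sum_i c i *: g i) ->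
  exists phi : 'I_n -> {linear F -> R^o}, forall y, e y = \sum_i phi i y *: g i.
Proof.
move=> projF gM.
have [|p pE] := @linear_bundle 'rV[R]_n M (fun c => \sum_i c 0 i *: g i).
  move=> a x y; rewrite scaler_sumr -big_split; apply: eq_bigr => i _ /=.
  by rewrite !mxE scalerDl scalerA.
have [x|h hE] := projF _ _ p e.
  have [c ->] := gM x; exists (\row_i c i); rewrite pE.
  by apply: eq_bigr => i _; rewrite mxE.
have /choice[phi phiE] i : exists f : {linear F -> R^o}, forall y, f y = h y 0 i.
  by apply: (@linear_bundle F R^o) => a x y; rewrite linearP !mxE.
exists phi => y; rewrite -hE pE; by apply: eq_bigr => i _; rewrite phiE.
Qed.

(** When [F] is projective and [e] is surjective, this says that multiplication
    by [r] on [M] factors through some projective module: any such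
    factorization can be moved to [F]. *)
Definition scalar_lifts {F M} (e : {linear F -> M}) (r : R) : Prop :=
  exists g : {linear M -> F}, forall x, e (g x) = r *: x.

(** Each generator [f m] of the trace ideal acts on [M] as [x |-> f x *: m],
    and this map lifts once [m] does. *)
Lemma trace_scalar_lifts F M (e : {linear F -> M}) r :
    (forall (f : {linear M -> R^o}) m x, f m *: x = f x *: m) ->
    (forall x, exists y, e y = x) ->
  trace_ideal M r -> scalar_lifts e r.
Proof.
move=> fC e_surj [n [f [m ->]]].
have /choice[y ey] i : exists y, e y = m i by exact: e_surj.
have [|g gE] := @linear_bundle M F (fun x => \sum_i f i x *: y i).
  move=> a x x'; rewrite scaler_sumr -big_split; apply: eq_bigr => i _ /=.
  by rewrite linearP scalerDl scalerA.
exists g => x; rewrite gE linear_sum scaler_suml; apply: eq_bigr => i _.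
by rewrite linearZ ey fC.
Qed.

(** * Annihilators of homology, and linearity of the tensor product *)

Lemma quotmod_proj_eq0 {V} (W : submodClosed V) (x : V) :
  quotmod_proj W x = 0 <-> x \in W.
Proof. by rewrite -(linear0 (quotmod_proj W)) quotmod_projP subr0. Qed.

Lemma homology_annP {A B C : lmodType R} (f : {linear A -> B})
    (g : {linear B -> C}) r :
  ann (homology f g) r <-> (forall b, g b = 0 -> exists a, f a = r *: b).
Proof.
pose W : submodClosed (ker g) := @boundaries R A B C f g.
split=> [rH b gb|rH u].
  have bK : b \in kermod g by apply/eqP.
  have /quotmod_proj_eq0/asboolP[a fa] : quotmod_proj W (r *: (Submod bK : ker g)) = 0.
    by rewrite linearZ; exact: rH.
  by exists a; rewrite fa linearZ.
have [z ->] := quotmod_reprP u; rewrite -linearZ.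
apply/quotmod_proj_eq0/asboolP; rewrite linearZ; apply: rH.
by apply/eqP; exact: (submod_valP z).
Qed.

Lemma ker_inclP U V (g : {linear U -> V}) (z : ker g) : g (ker_incl z) = 0.
Proof. exact/eqP/(submod_valP z). Qed.

Section TensorLinear.
Variables M N : lmodType R.

HB.instance Definition _ (x : M) :=
  GRing.isLinear.Build R N (tensor M N) *:%R (tmul x) (tmul_linearr x).

(** The product with its arguments swapped, so that linearity in the first one
    can be declared on a partial application. *)
Definition tmul_left (y : N) (x : M) : tensor M N := tmul x y.

Lemma tmul_leftE y x : tmul_left y x = tmul x y. Proof. by []. Qed.

HB.instance Definition _ (y : N) :=
  GRing.isLinear.Build R M (tensor M N) *:%R (tmul_left y) (tmul_linearl y).

End TensorLinear.

(** * Scalars that lift annihilate all higher Tor and Ext *)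

Section Resolution.
Variables (M : lmodType R) (P : proj_resolution M).

Lemma res_diff_aug y : res_aug P (res_diff P 0 y) = 0.
Proof. by apply/res_exact0; exists y. Qed.

Lemma res_diff_diff n y : res_diff P n (res_diff P n.+1 y) = 0.
Proof. by apply/res_exactS; exists y. Qed.

(** The map [r - h d] is killed by [d], so it lifts through the next
    differential. *)
Lemma homotopy_step r n (h : {linear P n -> P n.+1}) :
    (forall y, res_diff P n (h (res_diff P n y)) = r *: res_diff P n y) ->
  exists h1 : {linear P n.+1 -> P n.+2},
    forall y, res_diff P n.+1 (h1 y) + h (res_diff P n y) = r *: y.
Proof.
move=> hE.
pose k : {linear P n.+1 -> P n.+1} := (r \*: idfun) \- (h \o res_diff P n).
have [|h1 h1E] := projective_lift (d := res_diff P n.+1) (f := k)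
    (@res_proj R M P n.+1).
  by move=> z; apply/res_exactS; rewrite linearB /= linearZ /= hE subrr.
by exists h1 => y; rewrite h1E /= subrK.
Qed.

(** One component of the homotopy.  The identity [d h d = r d] is all that the
    next step of the construction requires of [h], and it has the same form in
    degree [0], where [h] comes from the lift of [r] to [P 0]. *)
Lemma scalar_lifts_diff r : scalar_lifts (res_aug P) r ->
  forall n, exists h : {linear P n -> P n.+1},
    forall y, res_diff P n (h (res_diff P n y)) = r *: res_diff P n y.
Proof.
move=> [g gE]; elim=> [|n [h /homotopy_step[h1 h1E]]].
  pose k : {linear P 0 -> P 0} := (r \*: idfun) \- (g \o res_aug P).
  have [|h hE] := projective_lift (d := res_diff P 0) (f := k)
      (@res_proj R M P 0).
    by move=> z; apply/res_exact0; rewrite linearB /= linearZ /= gE subrr.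
  by exists h => y; rewrite hE /= res_diff_aug linear0 subr0.
by exists h1 => y; rewrite -h1E res_diff_diff linear0 addr0.
Qed.

Lemma scalar_lifts_homotopy r : scalar_lifts (res_aug P) r ->
  forall n, exists (h : {linear P n -> P n.+1}) (h1 : {linear P n.+1 -> P n.+2}),
    forall y, res_diff P n.+1 (h1 y) + h (res_diff P n y) = r *: y.
Proof.
move=> rP n; have [h /homotopy_step[h1 hE]] := scalar_lifts_diff rP n.
by exists h, h1.
Qed.

Lemma scalar_lifts_T0 r : scalar_lifts (res_aug P) r -> T0 P r.
Proof.
move=> rP [//|n] _ N; have [h [h1 hE]] := scalar_lifts_homotopy rP n.
apply/homology_annP => b db; exists (tensor_map N h1 b).
pose lhs : {linear tensor (P n.+1) N -> tensor (P n.+1) N} :=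
  (tensor_map N (res_diff P n.+1) \o tensor_map N h1)
  \+ (tensor_map N h \o tensor_map N (res_diff P n)).
have lhsE : lhs =1 r \*: idfun.
  apply: tensor_ext => x y.
  by rewrite /= !tensor_mapE -!tmul_leftE -linearD hE linearZ.
by have := lhsE b; rewrite /= db linear0 addr0.
Qed.

Lemma scalar_lifts_E0 r : scalar_lifts (res_aug P) r -> E0 P r.
Proof.
move=> rP [//|n] _ N; have [h [h1 hE]] := scalar_lifts_homotopy rP n.
apply/homology_annP => b db.
pose bl : {linear P n.+1 -> N} := b; exists (bl \o h : {linear P n -> N}).
have bd y : bl (res_diff P n.+1 y) = 0.
  by have := congr1 (fun k : {linear P n.+2 -> N} => k y) db.
by apply: homP => y; rewrite [RHS]/(r *: bl y) -linearZ_LR -hE linearD bd add0r.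
Qed.

End Resolution.

(** * Recovering the lift from one Ext module *)

(** A comparison map [u : P 0 -> P' 0] over [M] restricts on boundaries to a
    cocycle with values in the syzygy of [P'], whose class is that of the
    extension 0 -> syzygy P' -> P' 0 -> M -> 0.  If [r] times this cocycle is the
    coboundary of [w], then [r u - w] vanishes on the boundaries of [P 0]; the
    map that it induces on [M] is the lift. *)
Lemma Ext_scalar_lifts {M} (P P' : proj_resolution M) r :
  ann (Ext P 1 (syzygy P')) r -> scalar_lifts (res_aug P') r.
Proof.
move=> /homology_annP rE.
have [z|u uE] := projective_lift (d := res_aug P') (f := res_aug P) (@res_proj _ _ P 0).
  exact: res_aug_surj.
pose ud : {linear P 1 -> P' 0} := u \o res_diff P 0.
have [|b bE] := @corestrict _ _ (kermod (res_aug P')) ud.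
  by move=> y; apply/eqP; rewrite /= uE res_diff_aug.
have [|w wE] := rE b.
  apply: homP => y; apply: val_inj; rewrite /= bE /= res_diff_diff.
  by rewrite linear0.
pose wl : {linear P 0 -> syzygy P'} := w.
have wd y : ker_incl (wl (res_diff P 0 y)) = r *: u (res_diff P 0 y).
  have /(congr1 ((@ker_incl _ _ _ _) : syzygy P' -> P' 0%N)) :=
    congr1 (fun k : {linear P 1%N -> syzygy P'} => k y) wE.
  by move=> ->; rewrite linearZ; congr (_ *: _); exact: bE.
pose k : {linear P 0 -> P' 0} := (r \*: u) \- (@ker_incl _ _ _ (res_aug P') \o wl).
have [||g gE] := @linear_factor _ _ _ (res_aug P) k.
- exact: res_aug_surj.
- by move=> _ /res_exact0[y <-]; rewrite /= wd subrr.
exists g => x; have [y <-] := res_aug_surj P x; rewrite gE linearB linearZ /= uE.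
by rewrite ker_inclP subr0.
Qed.

(** * Recovering the lift from one Tor module *)

Section RankOne.
Variables F X : lmodType R.

Definition rank_one_fun (x : X) (phi : {linear F -> R^o}) (y : F) : X := phi y *: x.

Fact rank_one_fun_linear x phi : linear (rank_one_fun x phi).
Proof. by move=> a y z; rewrite /rank_one_fun linearP scalerDl scalerA. Qed.

HB.instance Definition _ x phi :=
  GRing.isLinear.Build R F X *:%R (rank_one_fun x phi) (rank_one_fun_linear x phi).

Definition rank_one (x : X) (phi : Defs.hom F R^o) : Defs.hom F X :=
  rank_one_fun x phi : {linear F -> X}.

Fact rank_one_linear x : linear (rank_one x).
Proof.
move=> a phi psi; apply: homP => y.
pose c : R := (phi : {linear F -> R^o}) y; pose c' : R := (psi : {linear F -> R^o}) y.
have E : (a * c + c') *: x = a *: (c *: x) + c' *: x by rewrite scalerDl scalerA.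
exact: E.
Qed.

HB.instance Definition _ x :=
  GRing.isLinear.Build R (Defs.hom F R^o) (Defs.hom F X) *:%R (rank_one x)
    (rank_one_linear x).

Lemma rank_one_linearl a x x' phi :
  rank_one (a *: x + x') phi = a *: rank_one x phi + rank_one x' phi.
Proof.
apply: homP => y.
pose c : R := (phi : {linear F -> R^o}) y.
have E : c *: (a *: x + x') = a *: (c *: x) + c *: x'.
  by rewrite scalerDr !scalerA mulrC.
exact: E.
Qed.

Lemma hom_sumE n (k : 'I_n -> Defs.hom F X) y :
  ((\sum_i k i : Defs.hom F X) : {linear F -> X}) y
  = \sum_i (k i : {linear F -> X}) y.
Proof.
exact: (big_morph (fun k : Defs.hom F X => (k : {linear F -> X}) y)).
Qed.

(** A dual basis of [F] writes every map out of [F] as a sum of maps of rank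
    one. *)
Lemma hom_rank_one n (b : 'I_n -> F) (phi : 'I_n -> {linear F -> R^o})
    (k : {linear F -> X}) :
    (forall y, y = \sum_i phi i y *: b i) ->
  (k : Defs.hom F X) = \sum_i rank_one (k (b i)) (phi i).
Proof.
move=> phiE; apply: homP => y; rewrite hom_sumE {1}(phiE y) linear_sum.
by apply: eq_bigr => i _; rewrite linearZ.
Qed.

End RankOne.

(* The class of a map [F1 -> X] modulo the maps that factor through
   [f : F1 -> F0]. *)
Local Notation hom_class f X := (quotmod_proj (immod (hom_precomp X f))).
Local Notation transpose_coker f := (coker (hom_precomp R^o f)).

Section Tor.
Variables (F1 F0 : lmodType R) (f : {linear F1 -> F0}).
Local Notation T := (transpose_coker f).
Local Notation pr X := (hom_class f X).

(** The natural map from the tensor product of [X] and Tr M to the cokernel of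
    Hom (F0, X) -> Hom (F1, X).  It detects the Tor class of the identity; it is
    bijective when [F0] and [F1] are finitely generated projective. *)
Lemma tensor_coker_hom (X : lmodType R) :
  exists L : {linear tensor X T -> coker (hom_precomp X f)},
    forall x phi, L (tmul x (pr R^o phi)) = pr X (rank_one x phi).
Proof.
have /choice[b bE] (x : X) : exists g : {linear T -> coker (hom_precomp X f)},
    forall phi, g (pr R^o phi) = pr X (rank_one x phi).
  pose k : {linear Defs.hom F1 R^o -> coker (hom_precomp X f)} :=
    pr X \o rank_one x.
  apply: (@linear_factor _ _ _ (pr R^o : {linear _ -> T}) k).
    by move=> t; have [phi ->] := quotmod_reprP t; exists phi.
  move=> phi /quotmod_proj_eq0/asboolP[psi <-]; apply/quotmod_proj_eq0/asboolP.
  by exists (rank_one x psi); apply: homP.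
have bl t : linear (b^~ t).
  move=> a x x'; have [phi ->] := quotmod_reprP t.
  by rewrite !bE rank_one_linearl linearP.
have br x : linear (b x) by move=> a t t'; rewrite linearP.
have [L LE] := linear_bundle (tensor_lift_linear bl br).
by exists L => x phi; rewrite LE tensor_liftE.
Qed.

(** A weak form of the naturality in [X] of the previous map: boundaries of the
    tensor complex are sent to classes of maps [d \o v]. *)
Lemma tensor_coker_hom_map (X Y : lmodType R) (d : {linear X -> Y})
    (L : {linear tensor Y T -> coker (hom_precomp Y f)}) (s : tensor X T) :
    (forall y phi, L (tmul y (pr R^o phi)) = pr Y (rank_one y phi)) ->
  exists v : {linear F1 -> X}, L (tensor_map T d s) = pr Y (d \o v : {linear _ -> _}).
Proof.
move=> LE; have [l ->] := tensor_reprP s; elim: l => [|[x t] l [v vE]].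
  exists \0; rewrite tensor_class_nil !linear0 -[LHS](linear0 (pr Y)); congr (pr Y _).
  by apply: homP => y; rewrite /= linear0.
have [phi ->] := quotmod_reprP t.
exists ((rank_one x phi : {linear F1 -> X}) \+ v).
rewrite tensor_class_cons !linearD vE /= tensor_mapE LE -linearD; congr (pr Y _).
by apply: homP => y; rewrite /= linearD; congr (_ + _); rewrite linearZ.
Qed.

End Tor.

(** Lift the identity of [M] to a map [(u1, u0)] from the presentation to the
    resolution.  Since [d u1 = u0 f] factors through [f], the class of [u1] modulo
    maps that factor through [f] is a 1-cycle; through the natural map
    [tensor_coker_hom] it corresponds to the cycle [tau] of the tensor complex,
    obtained by expanding [u1] in a dual basis.  If [r *: tau] is a boundary, then
    [d1 v - r u1 = w f] for some [v] and [w], so [r u0 + d0 w] vanishes on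
    the image of [f]; the map that it induces on [M] is the lift. *)
Lemma Tor_scalar_lifts M (P : proj_resolution M) (p : fp_presentation M) r :
  ann (Tor P 1 (transpose p)) r -> scalar_lifts (res_aug P) r.
Proof.
move=> /homology_annP rT; set f := pres_map p.
pose T := transpose_coker f.
have [z|u0 u0E] := projective_lift (d := res_aug P) (f := pres_aug p) (@pres_proj0 _ _ p).
  exact: res_aug_surj.
pose u0f : {linear pres_P1 p -> P 0} := u0 \o f.
have [z|u1 u1E] := projective_lift (d := res_diff P 0) (f := u0f) (@pres_proj1 _ _ p).
  by apply/res_exact0; rewrite /= u0E; apply/pres_exact; exists z.
have [n1 [b1 /projective_coord b1E]] := pres_fin_gen1 p.
have [phi phiE] := b1E _ idfun (@pres_proj1 _ _ p).
have [n0 [b0 /projective_coord b0E]] := pres_fin_gen0 p.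
have [psi psiE] := b0E _ idfun (@pres_proj0 _ _ p).
have [L LE] := tensor_coker_hom f (P 1).
pose tau : tensor (P 1) T := \sum_i tmul (u1 (b1 i)) (hom_class f R^o (phi i)).
have Ltau : L tau = hom_class f _ u1.
  rewrite (hom_rank_one u1 phiE) /tau !linear_sum.
  by apply: eq_bigr => i _; exact: LE.
have dtau : tensor_map T (res_diff P 0) tau = 0.
  (* By the dual basis the sum is the class of [psi k \o f], which is zero in
     Tr M. *)
  have psif k : \sum_i psi k (f (b1 i)) *: hom_class f R^o (phi i) = 0.
    pose psifk : {linear pres_P1 p -> R^o} := psi k \o f.
    have -> : \sum_i psi k (f (b1 i)) *: hom_class f R^o (phi i)
        = hom_class f R^o psifk.
      rewrite (hom_rank_one psifk phiE) linear_sum; apply: eq_bigr => i _.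
      rewrite -linearZ; congr (hom_class f _ _); apply: homP => y.
      exact: mulrC.
    by apply/quotmod_proj_eq0/asboolP; exists (psi k).
  (* Expand [u0 (f (b1 i))] in the dual basis of [F0], and move the coefficients
     across the tensor sign. *)
  have dtauE i : tensor_map T (res_diff P 0) (tmul (u1 (b1 i)) (hom_class f R^o (phi i)))
      = \sum_k tmul (u0 (b0 k)) (psi k (f (b1 i)) *: hom_class f R^o (phi i)).
    rewrite tensor_mapE u1E /= [X in u0 X]psiE linear_sum -tmul_leftE linear_sum.
    by apply: eq_bigr => k _; rewrite !linearZ.
  rewrite linear_sum (eq_bigr _ (fun i _ => dtauE i)) exchange_big big1 // => k _.
  by rewrite -linear_sum psif linear0.
have [s sE] := rT tau dtau.
have [v vE] := tensor_coker_hom_map (res_diff P 1) s LE.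
have /quotmod_projP/asboolP[w wE] :
    hom_class f _ (res_diff P 1 \o v : {linear _ -> _})
    = hom_class f _ (r \*: u1 : {linear _ -> _}).
  by rewrite -[LHS]vE [X in L X]sE linearZ Ltau -linearZ_LR.
pose wl : {linear pres_P0 p -> P 1} := w.
have wf y : wl (f y) = res_diff P 1 (v y) - r *: u1 y.
  exact: (congr1 (fun k : {linear pres_P1 p -> P 1} => k y) wE).
pose k : {linear pres_P0 p -> P 0} := (r \*: u0) \+ (res_diff P 0 \o wl).
have [||g gE] := @linear_factor _ _ _ (pres_aug p) k.
- exact: pres_aug_surj.
- move=> _ /pres_exact[y <-].
  by rewrite /= wf linearB res_diff_diff linearZ u1E sub0r subrr.
exists g => x; have [y <-] := pres_aug_surj p x; rewrite gE linearD linearZ /= u0E.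
by rewrite res_diff_aug addr0.
Qed.

End LinearMaps.

(** * Fractional modules and the theorem *)

Section Fractional.
Variables (R Q : comPzRingType) (iota : {rmorphism R -> Q}).
Hypothesis fracQ : is_total_fractions iota.
Variables (M : lmodType R) (j : {linear M -> Q | iota \; *%R}).
Hypothesis inj_j : injective j.

Lemma tf_cancel s (x y : Q) :
  nonzerodivisor s -> iota s * x = iota s * y -> x = y.
Proof.
move=> /(tf_unit fracQ)[q sq] /(congr1 ( *%R q)).
by rewrite !mulrA [q * _]mulrC sq !mul1r.
Qed.

Lemma tf_inj : injective iota.
Proof. by move=> a b /(tf_eq fracQ)[s s_reg /s_reg]. Qed.

(** This is how [f] is multiplication by a fraction.  Clearing the denominators
    of [m] and [x] produces a common multiple of the two with coefficients in
    [R]; applying [f] to it compares [f x] with [f m]. *)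
Lemma tf_hom_exchange (f : {linear M -> R^o}) m x : f m *: x = f x *: m.
Proof.
have [a [s [s_reg jx]]] := tf_frac fracQ (j x).
have [b [t [t_reg jm]]] := tf_frac fracQ (j m).
have cross : (b * s) *: x = (a * t) *: m.
  apply: inj_j; rewrite !linearZ /= !rmorphM -jx -jm.
  by rewrite [LHS](ACl (4*3*2*1)).
have fcross : b * s * f x = a * t * f m.
  by have := congr1 f cross; rewrite !linearZ.
apply: inj_j; apply: (tf_cancel s_reg); apply: (tf_cancel t_reg).
rewrite !linearZ /= !mulrA.
rewrite [LHS](ACl (4*2*1*3)) [RHS](ACl (4*1*2*3)) /= jx jm -!rmorphM.
by rewrite -fcross.
Qed.

(** With [f i := phi i \o g], the element [r *: m] is
    [\sum_i f i m *: b i = (\sum_i f i (b i)) *: m] by the exchange formula, and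
    [m] is invertible in [Q]. *)
Lemma scalar_lifts_trace (F : lmodType R) (e : {linear F -> M}) r :
    fin_gen M -> (exists (m : M) (s : R), nonzerodivisor s /\ j m = iota s) ->
    projective F ->
  scalar_lifts e r -> trace_ideal M r.
Proof.
move=> [n [b bM]] [m [s [s_reg jm]]] projF [g gE].
have [phi phiE] := projective_coord e projF bM.
pose f i : {linear M -> R^o} := phi i \o g.
exists n, f, b; apply: tf_inj; apply: (tf_cancel s_reg).
rewrite -jm mulrC [RHS]mulrC -!linearZ; congr (j _).
rewrite -gE phiE scaler_suml; apply: eq_bigr => i _.
exact: (tf_hom_exchange (f i) m (b i)).
Qed.

End Fractional.

Theorem theorem3p3
  (R : comPzRingType) (noethR : noetherian R)
  (Q : comPzRingType) (iota : {rmorphism R -> Q})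
  (fracQ : is_total_fractions iota)
  (M : lmodType R) (fgM : fin_gen M)
  (* [M] as an [R]-submodule of [Q] *)
  (j : {linear M -> Q | iota \; *%R}) (inj_j : injective j)
  (M_nzd : exists (m : M) (s : R), nonzerodivisor s /\ j m = iota s)
  (P P' : proj_resolution M) (p : fp_presentation M) :
  [/\ trace_ideal M = T0 P,
      T0 P = ann (Tor P 1 (transpose p)),
      ann (Tor P 1 (transpose p)) = E0 P &
      E0 P = ann (Ext P 1 (syzygy P'))].
Proof.
have lifts r : trace_ideal M r -> scalar_lifts (res_aug P) r.
  apply: trace_scalar_lifts; last exact: res_aug_surj.
  exact: (tf_hom_exchange fracQ inj_j).
have trace (P1 : proj_resolution M) r :
    scalar_lifts (res_aug P1) r -> trace_ideal M r.
  apply: (scalar_lifts_trace fracQ inj_j fgM M_nzd); exact: (@res_proj _ _ P1 0).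
have trT0 : trace_ideal M = T0 P.
  apply/seteqP; split=> r; first by move/lifts/scalar_lifts_T0.
  by move=> rT; apply/(trace P)/(Tor_scalar_lifts (p := p))/rT.
have trT1 : trace_ideal M = ann (Tor P 1 (transpose p)).
  apply/seteqP; split=> r; first by rewrite trT0; apply.
  by move/Tor_scalar_lifts/trace.
have trE0 : trace_ideal M = E0 P.
  apply/seteqP; split=> r; first by move/lifts/scalar_lifts_E0.
  by move=> rE; apply/(trace P)/(Ext_scalar_lifts (P := P))/rE.
have trE1 : trace_ideal M = ann (Ext P 1 (syzygy P')).
  apply/seteqP; split=> r; first by rewrite trE0; apply.
  by move/Ext_scalar_lifts/trace.
by split; rewrite -?trT0 -?trT1 -?trE0 -?trE1.
Qed.
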